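(* For every $n\ge 1$, $$R_n(x,y,z,t) = \sum_{T \in \mathcal{C}_{n+1}} (y+1)^{\mathrm{impe}(T)-\mathrm{impp}(T)}\,(y+t)^{\mathrm{impp}(T)}\, x^{\deg_T(1)-1}\, z^{\mathrm{lead}(T)-\deg_T(1)-1}.$$
   Context: Polynomials $Q_n(x,y,z,t)$ are defined by $Q_1=1$ and $Q_{n+1} = \left[x+nz+(y+t)\left(n+y\,\partial_y\right)\right]Q_n$, and $R_n(x,y,z,t) := Q_n(x,y+1,z,t-1)$. $\mathcal{C}_m$ is the set of Cayley trees on $[m]$ (trees with vertex set labelled bijectively by $[m]$) rooted at $1$; edges $(i,j)$ are oriented from parent $i$ to child $j$, and $\lambda_T$ denotes the label. For a vertex $v$, $\beta_T(v)$ is the smallest label among the descendants of $v$ ($v$ included). An edge $(i,j)$ is improper if $\lambda_T(i)>\beta_T(j)$, proper otherwise; $\mathrm{impe}(T)$ is the number of improper edges. A vertex is an improper parent if it has at least one improper child; $\mathrm{impp}(T)$ is the number of improper parents. $\deg_T(1)$ is the degree of the root. For a vertex $i$ with root-to-$i$ path $L(i)=(1=a_0,\dots,a_k=i)$, its greater ancestors path is the longest suffix $(a_p,\dots,a_k)$ of $L(i)$ whose vertices $j$ all satisfy $\lambda_T(j)\ge\lambda_T(i)$; $i$ is leading if $\beta_T(a_p)=\lambda_T(i)$; $\mathrm{lead}(T)$ is the number of leading vertices. *)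

(* Defs.v *)
From HB Require Import structures.
From mathcomp Require Import all_boot all_order all_algebra.
From mathcomp Require Import mpoly.
Set Implicit Arguments. Unset Strict Implicit. Unset Printing Implicit Defensive.
Import Order.TTheory GRing.Theory Num.Theory.
Local Open Scope ring_scope.

Notation P4 := {mpoly int[4]}.
Definition ix : 'I_4 := @Ordinal 4 0 isT.
Definition iy : 'I_4 := @Ordinal 4 1 isT.
Definition iz : 'I_4 := @Ordinal 4 2 isT.
Definition it : 'I_4 := @Ordinal 4 3 isT.
Definition vx : P4 := 'X_ix.
Definition vy : P4 := 'X_iy.
Definition vz : P4 := 'X_iz.
Definition vt : P4 := 'X_it.

Definition Qstep (n : nat) (q : P4) : P4 :=
  vx * q + n%:R * vz * q + (vy + vt) * (n%:R * q + vy * mderiv iy q).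

(* Qaux k = Q_{k+1}:  Q_1 = 1,  Q_{n+1} = Qstep n Q_n. *)
Fixpoint Qaux (k : nat) : P4 :=
  if k is k'.+1 then Qstep k'.+1 (Qaux k') else 1.

(* Q n = Q_n for n >= 1 (Q 0 is a junk value, never used). *)
Definition Q (n : nat) : P4 := Qaux n.-1.

Definition Rpoly (n : nat) : P4 :=
  Q n \mPo [tuple vx; vy + 1; vz; vt - 1].

(* Cayley trees on [m] rooted at 1.  Vertex i : 'I_m carries label i+1,    *)
(* so the label order is the order on 'I_m and the root is ord0.  A rooted *)
(* tree is encoded by its parent function f (with f root = root): every    *)
(* vertex reaches the root by iterating f.  Edge (f j, j) for j <> root,  *)
(* oriented from parent f j to child j.                                   *)
Section Trees.
Variable m : nat.
Implicit Types (f : {ffun 'I_m.+1 -> 'I_m.+1}) (i j u v w : 'I_m.+1).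

Definition root : 'I_m.+1 := ord0.

Definition is_tree f : bool :=
  (f root == root) && [forall v, iter m.+1 f v == root].

Definition anc f u v : bool := [exists k : 'I_m.+1, iter k f v == u].

Definition beta f v : nat := \big[minn/(v : nat)]_(w | anc f v w) (w : nat).

Definition improper_edge f j : bool := (j != root) && (beta f j < f j)%N.

Definition impe f : nat := #|[set j | improper_edge f j]|.

Definition impp f : nat :=
  #|[set i | [exists j, improper_edge f j && (f j == i)]]|.

Definition deg_root f : nat := #|[set j | (j != root) && (f j == root)]|.

(* Greater ancestors path of i: the longest suffix (a_p, ..., a_k = i) of   *)
(* the root-to-i path with all labels >= label i.  It consists of the      *)
(* vertices iter l f i for l <= gap f i, where gap f i is the largest      *)
(* number of steps up such that all vertices met have label >= label i;    *)
(* its top vertex a_p is gtop f i.                                         *)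
Definition gap f i : nat :=
  \max_(k < m.+1 | [forall l : 'I_k.+1, (i <= iter l f i)%N]) (k : nat).

Definition gtop f i : 'I_m.+1 := iter (gap f i) f i.

Definition leading f i : bool := beta f (gtop f i) == (i : nat).

Definition lead f : nat := #|[set i | leading f i]|.

End Trees.

(* Main.v *)
(* The recurrence for Q_n is realised by inserting the largest label N into a
   tree T on the smaller labels.  Attaching N as a leaf costs a factor x at the
   root and z at any other vertex.  If N is internal in T', all its child edges
   are improper; let i be its child with the largest beta, contract the edge
   (N, i) into i and hang the other children of N on i, where they become the
   improper children of i with the smallest beta.  Conversely, given a vertex
   i <> 1 with r improper children, N is inserted above i and takes over any
   number 0 <= s <= r of the improper children of i, those with the smallest
   beta.  The degree of the root and the number of leading vertices do not
   change, impe grows by one, and impp grows by one unless s = r >= 1.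
   Writing u = y and w = y + t, this is the recurrence
   Q_{n+1} = (x + n z + n w) Q_n + w u (d/du + d/dw) Q_n
   for the sum of the monomials u^(impe - impp) w^impp x^(deg - 1)
   z^(lead - deg - 1). *)
Require Import Defs.
From HB Require Import structures.
From mathcomp Require Import all_boot all_order all_algebra.
From mathcomp Require Import zify ring.
From mathcomp Require Import mpoly.
Import GRing.Theory.
Set Implicit Arguments. Unset Strict Implicit. Unset Printing Implicit Defensive.
Local Open Scope nat_scope.

Local Notation root := Defs.root.

(** * Trees as parent functions: ancestors, smallest descendants, leading vertices *)

Section TreeBasics.
Variable m : nat.
Implicit Types (f : {ffun 'I_m.+1 -> 'I_m.+1}) (i j u v w : 'I_m.+1).

(** An orbit has at most [m.+1] points, so bounding the number of steps in [anc] loses nothing. *)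
Lemma anc_fconnect f u v : anc f u v = fconnect f v u.
Proof.
apply/existsP/idP => [[k /eqP <-]|vu]; first exact: fconnect_iter.
have lt_k : findex f v u < m.+1.
  apply: leq_trans (findex_max vu) _.
  by apply: leq_trans (max_card _) _; rewrite card_ord.
by exists (Ordinal lt_k); rewrite iter_findex.
Qed.

Lemma anc_refl f v : anc f v v.
Proof. by rewrite anc_fconnect connect0. Qed.

Lemma anc_trans f u v w : anc f u v -> anc f v w -> anc f u w.
Proof. rewrite !anc_fconnect => uv vw; exact: connect_trans vw uv. Qed.

Lemma ancE f u v : anc f u v = (v == u) || anc f u (f v).
Proof. by rewrite !anc_fconnect fconnect_eqVf. Qed.

Lemma anc_parent f u v : anc f u (f v) -> anc f u v.
Proof. by rewrite (ancE f u v) => ->; rewrite orbT. Qed.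

Lemma iter_root f k : f (root m) = root m -> iter k f (root m) = root m.
Proof. by move=> fr; elim: k => //= k ->. Qed.

Lemma iter_root_ge f v k l : f (root m) = root m ->
  iter k f v = root m -> k <= l -> iter l f v = root m.
Proof. by move=> fr kv /subnK <-; rewrite iterD kv iter_root. Qed.

Lemma is_treeP f :
  reflect (f (root m) = root m /\ forall v, anc f (root m) v) (is_tree f).
Proof.
apply: (iffP andP) => [[/eqP fr /forallP tr]|[fr tr]]; split; rewrite ?fr //.
- by move=> v; rewrite anc_fconnect -(eqP (tr v)) fconnect_iter.
- apply/forallP => v; have /existsP[k /eqP kv] := tr v.
  by apply/eqP/(iter_root_ge fr kv); apply: ltnW.
Qed.

Lemma tree_root f : is_tree f -> f (root m) = root m.
Proof. by case/is_treeP. Qed.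

(** Induction on the number of steps up to the root; most comparisons between a tree and its
    enlargement rest on it. *)
Lemma tree_ind f (P : 'I_m.+1 -> Prop) : is_tree f -> P (root m) ->
  (forall v, v != root m -> P (f v) -> P v) -> forall v, P v.
Proof.
case/is_treeP => _ tr Pr PS v; have /existsP[[k /= _] /eqP] := tr v.
elim: k v => [|k IHk] v /=; first by move=> ->.
rewrite -iterS iterSr => /IHk; case: (eqVneq v (root m)) => [->//|nr].
exact: PS.
Qed.

Lemma anc_root f u : is_tree f -> anc f u (root m) = (u == root m).
Proof.
move=> /tree_root fr; apply/existsP/eqP => [[k /eqP <-]|->].
  by rewrite iter_root.
by exists ord0.
Qed.

(** A cycle through [v] would bring [v] back after arbitrarily many steps, whereas from [m.+1] steps
    on every iterate is the root. *)
Lemma tree_acyclic f v : is_tree f -> v != root m -> anc f v (f v) = false.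
Proof.
move=> /andP[/eqP fr /forallP tr] nr; apply: contraNF nr => /existsP[k /eqP kv].
have cyc t : iter (t * k.+1) f v = v.
  by elim: t => // t IHt; rewrite mulSn iterD IHt iterSr.
rewrite -(cyc m.+1); apply/eqP/(iter_root_ge fr (eqP (tr v))).
by rewrite leq_pmulr.
Qed.

Lemma anc_total f u v w : anc f u w -> anc f v w -> anc f u v || anc f v u.
Proof.
case/existsP=> k /eqP <- /existsP[l /eqP <-].
by case: (leqP k l) => [/subnK <-|/ltnW/subnK <-];
  rewrite iterD !anc_fconnect fconnect_iter ?orbT.
Qed.

(** Two ancestors of [w] are comparable, and a vertex strictly above its sibling would be above its
    own parent. *)
Lemma tree_siblings_disjoint f u v w : is_tree f -> u != root m ->
  v != root m -> f u = f v -> anc f u w -> anc f v w -> u = v.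
Proof.
move=> tf nu nv fuv uw vw; have /orP[] := anc_total uw vw.
  by rewrite ancE -fuv tree_acyclic // orbF => /eqP.
by rewrite ancE fuv tree_acyclic // orbF => /eqP.
Qed.

Lemma beta_le f v w : anc f v w -> beta f v <= w.
Proof.
rewrite /beta => vw; have : w \in index_enum 'I_m.+1 by rewrite mem_index_enum.
elim: (index_enum _) => //= x s IHs; rewrite inE big_cons.
by case/orP=> [/eqP<-|/IHs le_w]; rewrite ?vw; last case: ifP => _; lia.
Qed.

Lemma beta_attained f v : exists2 w, anc f v w & beta f v = w.
Proof.
rewrite /beta; elim/big_rec: _ => [|w x vw [w' vw' ->]].
  by exists v; rewrite ?anc_refl.
by case: (leqP w w') => _; [exists w|exists w'].
Qed.

Lemma beta_le_self f v : beta f v <= v.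
Proof. exact: beta_le (anc_refl f v). Qed.

Lemma beta_lt f v : beta f v < m.+1.
Proof. exact: leq_ltn_trans (beta_le_self f v) (ltn_ord v). Qed.

Lemma beta_anc f u v : anc f u v -> beta f u <= beta f v.
Proof. by have [w vw ->] := beta_attained f v => uv;
  exact/beta_le/(anc_trans uv vw). Qed.

(** A common value would be the label of a vertex below both siblings. Hence [beta] orders the
    children of a vertex strictly. *)
Lemma tree_siblings_beta_inj f u v : is_tree f -> u != root m ->
  v != root m -> f u = f v -> beta f u = beta f v -> u = v.
Proof.
move=> tf nu nv fuv buv.
have [w uw bw] := beta_attained f u; have [w' vw' bw'] := beta_attained f v.
have eww' : w = w' by apply: val_inj; rewrite /= -bw -bw'.
by apply: (tree_siblings_disjoint tf nu nv fuv uw); rewrite eww'.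
Qed.

(* Some vertex reached from v by going up through labels >= b has a descendant
   smaller than b; for v = b this says that v is not leading. *)
Definition climbs_below f (b : nat) v : Prop :=
  exists2 k, (forall l, l <= k -> b <= iter l f v) & beta f (iter k f v) < b.

Lemma climbs_belowE f b v : climbs_below f b v <->
  b <= v /\ (beta f v < b \/ climbs_below f b (f v)).
Proof.
split.
  case=> [[|k] bl bk]; first by split; [exact: (bl 0)|left].
  split; [exact: (bl 0)|right; exists k; last by rewrite -iterSr].
  by move=> l lk; rewrite -iterSr; exact: bl.
case=> bv [bv'|[k bl bk]].
  by exists 0 => // l; rewrite leqn0 => /eqP->.
exists k.+1; last by rewrite iterSr.
by case=> [|l] lk //; rewrite iterSr; exact: bl.
Qed.

(** The root has label 0, so the climb forces [b = 0], and no value lies below 0. *)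
Lemma climbs_below_root f b : is_tree f -> ~ climbs_below f b (root m).
Proof.
move=> /tree_root fr [k /(_ 0 isT) /=]; rewrite leqn0 => /eqP ->.
by rewrite iter_root.
Qed.

(** Going up, [beta] can only decrease, so a value below [i] met on the greater ancestors path
    persists at its top. There [beta] is at most [i], since [i] is a descendant. *)
Lemma leadingP f i : is_tree f -> leading f i <-> ~ climbs_below f i i.
Proof.
move=> tf; rewrite /leading /gtop.
pose P (k : 'I_m.+1) := [forall l : 'I_k.+1, i <= iter l f i].
have PP (k : 'I_m.+1) : reflect (forall l, l <= k -> i <= iter l f i) (P k).
  apply: (iffP forallP) => [H l lk|H l]; last by apply: H; rewrite -ltnS.
  exact: (H (@Ordinal k.+1 l lk)).
have P0 : P ord0 by apply/PP => l; rewrite leqn0 => /eqP->.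
have [k Pk gk] : exists2 k : 'I_m.+1, P k & gap f i = k.
  have nz : 0 < #|[pred k | P k]| by apply/card_gt0P; exists ord0.
  by have [k Pk gk] := eq_bigmax_cond (fun k : 'I_m.+1 => k : nat) nz; exists k.
have gmax (k' : 'I_m.+1) : P k' -> k' <= gap f i.
  by move=> Pk'; rewrite /gap (bigD1 k') //= leq_maxl.
have le_i : beta f (iter k f i) <= i by apply: beta_le;
  rewrite anc_fconnect fconnect_iter.
rewrite gk; split=> [/eqP bi|ncl].
  case=> k' Hk' bk'.
  have [lt_k'|le_k'] := ltnP k' m.+1.
    have : k' <= gap f i by apply: (gmax (Ordinal lt_k')); apply/PP.
    rewrite gk => le_k'; move: bk'; rewrite ltnNge => /negP; apply.
    rewrite -{1}bi; apply: beta_anc.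
    by rewrite anc_fconnect -(subnK le_k') iterD fconnect_iter.
  (* A climb of more than [m] steps meets the root, so [i] is 0 and nothing is smaller. *)
  have := Hk' _ le_k'; case/andP: tf => /eqP fr /forallP /(_ i)/eqP -> /=.
  by rewrite leqn0 => /eqP i0; rewrite i0 in bk'.
rewrite eqn_leq le_i leqNgt; apply/negP => lt_i; apply: ncl.
by exists k => //; apply/PP.
Qed.

(** Sending an improper edge to its parent reaches every improper parent. The truncated difference
    [impe f - impp f] is therefore exact. *)
Lemma impp_le_impe f : impp f <= impe f.
Proof.
apply: leq_trans (leq_imset_card f [set j | improper_edge f j]).
apply/subset_leq_card/fintype.subsetP => i;
  rewrite inE => /existsP[j /andP[ij /eqP <-]].
by apply: imset_f; rewrite inE.
Qed.

End TreeBasics.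

(** * The smaller label set inside the larger one *)

Section Embedding.
Variable m : nat.
Implicit Types (v : 'I_m.+1) (x : 'I_m.+2).

Definition emb v : 'I_m.+2 := lift ord_max v.

Lemma val_emb v : emb v = v :> nat.
Proof. exact: lift_max. Qed.

Lemma emb_inj : injective emb.
Proof. exact: lift_inj. Qed.

Lemma emb_neq_max v : (emb v == ord_max) = false.
Proof. by rewrite eq_sym; apply/negbTE/neq_lift. Qed.

Lemma emb_root : emb (root m) = root m.+1.
Proof. by apply: val_inj; exact: (val_emb (root m)). Qed.

Lemma emb_eq_root v : (emb v == root m.+1) = (v == root m).
Proof. by rewrite -emb_root (inj_eq emb_inj). Qed.

Variant emb_spec : 'I_m.+2 -> Type :=
  | EmbMax : emb_spec ord_max
  | Emb v : emb_spec (emb v).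

Lemma embP x : emb_spec x.
Proof. by case: (unliftP ord_max x) => [v|] ->; constructor. Qed.

Lemma card_emb (P : pred 'I_m.+2) :
  #|[set x | P x]| = #|[set v | P (emb v)]| + P ord_max.
Proof.
rewrite -!sum1dep_card big_mkcond big_ord_recr /= -big_mkcond /=; congr (_ + _).
by apply: eq_bigl => v; congr P; apply: ord_inj; rewrite val_emb.
Qed.

(** The new label exceeds all others, so its presence among the descendants of [x] does not affect
    their minimum. *)
Lemma beta_emb (f : {ffun 'I_m.+1 -> 'I_m.+1}) (T : {ffun 'I_m.+2 -> 'I_m.+2})
  x u :
  (forall v, anc T x (emb v) = anc f u v) -> beta T x = beta f u.
Proof.
move=> eq_anc; apply/eqP; rewrite eqn_leq; apply/andP; split.
  by have [w uw ->] := beta_attained f u; rewrite -(val_emb w) beta_le ?eq_anc.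
have [w xw ->] := beta_attained T x; case: (embP w) xw => [_|v].
  exact/ltnW/beta_lt.
by rewrite val_emb eq_anc => /beta_le.
Qed.

End Embedding.

(* Vertex v of the smaller tree becomes emb v, and the new largest label is
   ord_max: it gets parent p and children A. *)
Definition graft m (f : {ffun 'I_m.+1 -> 'I_m.+1}) (p : 'I_m.+1)
    (A : {set 'I_m.+1}) : {ffun 'I_m.+2 -> 'I_m.+2} :=
  [ffun x => if unlift ord_max x is Some y
             then (if y \in A then ord_max else emb (f y)) else emb p].

Section Graft.
Variables (m : nat) (f : {ffun 'I_m.+1 -> 'I_m.+1}) (p : 'I_m.+1).
Variable A : {set 'I_m.+1}.

Lemma graft_max : graft f p A ord_max = emb p.
Proof. by rewrite ffunE unlift_none. Qed.

Lemma graft_emb v : graft f p A (emb v) = if v \in A then ord_max else emb (f v).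
Proof. by rewrite ffunE liftK. Qed.

End Graft.

(** * Attaching the largest label as a leaf *)

Section Leaf.
Variables (m : nat) (f : {ffun 'I_m.+1 -> 'I_m.+1}) (p : 'I_m.+1).
Hypothesis tf : is_tree f.
Let L := graft f p set0.

Lemma leaf_emb v : L (emb v) = emb (f v).
Proof. by rewrite graft_emb inE. Qed.

Lemma leaf_anc u v : anc L (emb u) (emb v) = anc f u v.
Proof.
have Lr : L (root m.+1) = root m.+1 by rewrite -emb_root leaf_emb tree_root.
move: v; apply: (tree_ind tf) => [|v nv IHv].
  rewrite anc_root // emb_root; apply/existsP/eqP => [[k /eqP]|->].
    by rewrite iter_root // -emb_root => /emb_inj.
  by exists ord0; rewrite /= emb_root.
by rewrite ancE leaf_emb IHv (inj_eq (@emb_inj _)) -ancE.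
Qed.

Lemma leaf_tree : is_tree L.
Proof.
apply/is_treeP; split; first by rewrite -emb_root leaf_emb tree_root.
have [_ tr] := is_treeP _ tf.
by move=> x; case: (embP x) => [|v];
  rewrite ?[anc _ _ ord_max]ancE ?graft_max -emb_root leaf_anc tr ?orbT.
Qed.

Lemma leaf_anc_max v : anc L ord_max (emb v) = false.
Proof.
move: v; apply: (tree_ind tf) => [|v nv IHv].
  by rewrite emb_root anc_root ?leaf_tree.
by rewrite ancE emb_neq_max leaf_emb.
Qed.

Lemma leaf_beta v : beta L (emb v) = beta f v.
Proof. by apply: beta_emb => w; apply: leaf_anc. Qed.

Lemma leaf_beta_max : beta L ord_max = m.+1.
Proof.
have [w] := beta_attained L ord_max; case: (embP w) => [_ ->//|v].
by rewrite leaf_anc_max.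
Qed.

Lemma leaf_improper v : improper_edge L (emb v) = improper_edge f v.
Proof. by rewrite /improper_edge emb_eq_root leaf_beta leaf_emb val_emb. Qed.

Lemma leaf_improper_max : improper_edge L ord_max = false.
Proof.
rewrite /improper_edge leaf_beta_max graft_max val_emb /=.
by have := ltn_ord p; lia.
Qed.

Lemma leaf_impe : impe L = impe f.
Proof.
rewrite /impe card_emb leaf_improper_max addn0.
by apply: eq_card => v; rewrite !inE leaf_improper.
Qed.

Lemma leaf_impp : impp L = impp f.
Proof.
rewrite /impp card_emb [X in _ + X](_ : _ = 0); last first.
  apply/eqP; rewrite eqb0; apply/existsP => -[x]; case: (embP x) => [|v].
    by rewrite leaf_improper_max.
  by rewrite leaf_emb emb_neq_max andbF.
rewrite addn0; apply: eq_card => v; rewrite !inE.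
apply/existsP/existsP => [[x]|[w]].
  case: (embP x) => [|w]; first by rewrite leaf_improper_max.
  by rewrite leaf_improper leaf_emb (inj_eq (@emb_inj _)); exists w.
by exists (emb w); rewrite leaf_improper leaf_emb (inj_eq (@emb_inj _)).
Qed.

Lemma leaf_deg : deg_root L = deg_root f + (p == root m).
Proof.
rewrite /deg_root card_emb graft_max emb_eq_root; congr (_ + _).
by apply: eq_card => v; rewrite !inE leaf_emb !emb_eq_root.
Qed.

Lemma leaf_climbs b v : climbs_below L b (emb v) <-> climbs_below f b v.
Proof.
move: v; apply: (tree_ind tf) => [|v nv IHv].
  rewrite emb_root; split=> H; first by have := climbs_below_root leaf_tree H.
  by have := climbs_below_root tf H.
by rewrite climbs_belowE (climbs_belowE f) val_emb leaf_beta leaf_emb IHv.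
Qed.

Lemma leaf_leading v : leading L (emb v) = leading f v.
Proof.
apply/idP/idP; rewrite !leadingP ?leaf_tree //.
  by rewrite val_emb leaf_climbs.
by rewrite val_emb leaf_climbs.
Qed.

(** The parent has a smaller label, so the greater ancestors path of the new leaf is the leaf
    alone. *)
Lemma leaf_leading_max : leading L ord_max.
Proof.
apply/leadingP; first exact: leaf_tree.
rewrite climbs_belowE leaf_beta_max graft_max ltnn => -[_ [//|]].
by rewrite climbs_belowE val_emb /= leqNgt ltn_ord => -[].
Qed.

Lemma leaf_lead : lead L = (lead f).+1.
Proof.
rewrite /lead card_emb leaf_leading_max addn1; congr _.+1.
by apply: eq_card => v; rewrite !inE leaf_leading.
Qed.

End Leaf.

(** * Inserting the largest label on the edge above [i], where it takes over the children [S] of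
    [i] *)

Definition improper_parent m (f : {ffun 'I_m.+1 -> 'I_m.+1}) (i : 'I_m.+1) :=
  [exists j, improper_edge f j && (f j == i)].

Definition insert m (f : {ffun 'I_m.+1 -> 'I_m.+1}) (i : 'I_m.+1)
  (S : {set 'I_m.+1}) := graft f (f i) (i |: S).

Section Insert.
Variables (m : nat) (f : {ffun 'I_m.+1 -> 'I_m.+1}) (i : 'I_m.+1).
Variable S : {set 'I_m.+1}.
Hypothesis tf : is_tree f.
Hypothesis ni : i != root m.
Hypothesis Sch : forall j, j \in S -> f j = i.
Let T := insert f i S.

Lemma insert_max : T ord_max = emb (f i).
Proof. exact: graft_max. Qed.

Lemma insert_self : T (emb i) = ord_max.
Proof. by rewrite /T /insert graft_emb setU11. Qed.

Lemma insert_moved j : j \in S -> T (emb j) = ord_max.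
Proof. by move=> Sj; rewrite /T /insert graft_emb in_setU1 Sj orbT. Qed.

Lemma insert_fixed v : v != i -> v \notin S -> T (emb v) = emb (f v).
Proof.
by move=> /negbTE nvi /negbTE nvS; rewrite /T /insert graft_emb in_setU1 nvi nvS.
Qed.

Lemma child_neq j : f j = i -> j != i.
Proof.
move=> fj; apply/eqP => ji; have := tree_acyclic tf ni.
by rewrite -{2}ji fj anc_refl.
Qed.

Lemma insert_tree : is_tree T.
Proof.
have Tr : T (root m.+1) = root m.+1.
  rewrite -emb_root insert_fixed ?tree_root // 1?eq_sym //.
  by apply: contra ni => /Sch; rewrite tree_root // => ->.
have tr v : anc T (root m.+1) (emb v).
  move: v; apply: (tree_ind tf) => [|v nv]; first by rewrite emb_root anc_refl.
  case: (boolP (v \in S)) => [Sv|nSv].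
    rewrite (Sch Sv) [anc _ _ (emb v)]ancE insert_moved // ancE insert_self.
    by rewrite emb_eq_root (negbTE ni) /= => ->; rewrite orbT.
  case: (eqVneq v i) => [->|nvi] IHv;
    last by rewrite ancE insert_fixed // IHv orbT.
  by rewrite ancE insert_self ancE insert_max IHv !orbT.
apply/is_treeP; split=> // x; case: (embP x) => // .
by rewrite ancE insert_max tr orbT.
Qed.

Lemma insert_anc_max v : anc T ord_max (emb v) = anc f i v.
Proof.
move: v; apply: (tree_ind tf) => [|v nv IHv].
  by rewrite emb_root !anc_root ?insert_tree // (negbTE ni).
rewrite ancE emb_neq_max (ancE f).
case: (boolP (v \in S)) => [Sv|nSv].
  by rewrite insert_moved // (Sch Sv) !anc_refl !orbT.
case: (eqVneq v i) => [->|nvi]; first by rewrite insert_self anc_refl.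
by rewrite insert_fixed.
Qed.

(** A path through a moved child bypasses [i] via [ord_max] and rejoins the old path at [f i], so
    only [i] itself can lose descendants. *)
Lemma insert_anc_neq u v : u != i -> anc T (emb u) (emb v) = anc f u v.
Proof.
move=> nui; have emax : anc T (emb u) ord_max = anc T (emb u) (emb (f i)).
  by rewrite ancE insert_max eq_sym emb_neq_max.
move: v; apply: (tree_ind tf) => [|v nv IHv].
  by rewrite emb_root !anc_root ?insert_tree // emb_eq_root.
rewrite ancE (ancE f) (inj_eq (@emb_inj _)); congr (_ || _).
case: (boolP (v \in S)) => [Sv|nSv].
  rewrite insert_moved // -IHv (Sch Sv) [RHS]ancE insert_self.
  by rewrite (inj_eq (@emb_inj _)) [i == u]eq_sym (negbTE nui).
case: (eqVneq v i) => [vi|nvi]; last by rewrite insert_fixed.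
by rewrite vi insert_self emax -vi.
Qed.

Lemma insert_anc_self v : anc T (emb i) (emb v) -> anc f i v.
Proof.
move=> iv; rewrite -insert_anc_max; apply: anc_trans iv.
by rewrite ancE insert_self anc_refl orbT.
Qed.

(** The subtrees of the moved children leave [i]; this bounds the new [beta] of [i] from below. *)
Lemma insert_anc_self_inv v : anc T (emb i) (emb v) ->
  v = i \/ exists2 k, f k = i /\ k \notin S & anc f k v.
Proof.
move: v; apply: (tree_ind tf) => [|v nv IHv].
  by rewrite emb_root anc_root ?insert_tree // emb_eq_root (negbTE ni).
rewrite ancE => /orP[/eqP/emb_inj|]; first by left.
case: (boolP (v \in S)) => [Sv|nSv].
  rewrite insert_moved // ancE insert_max eq_sym emb_neq_max => /insert_anc_self.
  by rewrite tree_acyclic.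
case: (eqVneq v i) => [->|nvi]; first by left.
rewrite insert_fixed // => /IHv[fv|[k ki kv]].
  by right; exists v; rewrite ?anc_refl.
by right; exists k => //; apply: anc_parent.
Qed.

Lemma insert_beta v : v != i -> beta T (emb v) = beta f v.
Proof. by move=> nvi; apply: beta_emb => w; apply: insert_anc_neq. Qed.

Lemma insert_beta_max : beta T ord_max = beta f i.
Proof. by apply: beta_emb => w; apply: insert_anc_max. Qed.

Lemma insert_beta_self_ge : beta f i <= beta T (emb i).
Proof.
rewrite -insert_beta_max; apply: beta_anc.
by rewrite ancE insert_self anc_refl orbT.
Qed.

Lemma insert_beta_self_le : beta T (emb i) <= i.
Proof. by rewrite -(val_emb i) beta_le_self. Qed.

Lemma insert_beta_self_child k : f k = i -> k \notin S ->
  beta T (emb i) <= beta f k.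
Proof.
move=> fk nSk; have nki := child_neq fk; rewrite -insert_beta //.
by apply: beta_anc; rewrite ancE insert_fixed // fk anc_refl orbT.
Qed.

Lemma insert_deg : deg_root T = deg_root f.
Proof.
rewrite /deg_root card_emb insert_max (cardsD1 i) [RHS](cardsD1 i) !inE.
rewrite insert_self emb_eq_root ni andbF add0n addnC; congr (_ + _).
apply: eq_card => v; rewrite !inE !emb_eq_root.
case: (eqVneq v i) => //= nvi; case: (boolP (v \in S)) => [Sv|nSv].
  by rewrite insert_moved // (Sch Sv) (negbTE ni).
by rewrite insert_fixed // emb_eq_root.
Qed.

Hypothesis Sbeta : forall j, j \in S -> beta f j < i.

(** The extra vertex [ord_max] passes the test against [b] and has the old [beta] of [i]. A climb
    from a child [v] in [S] skips [i] and hence the test [b <= i], but by [Sbeta] either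
    [beta f v < b] already ends the climb or [b <= beta f v < i]. *)
Lemma insert_climbs b v : climbs_below T b (emb v) <-> climbs_below f b v.
Proof.
have climbs_max (u : 'I_m.+1) : b <= u -> climbs_below T b ord_max <->
    beta f i < b \/ climbs_below T b (emb (f i)).
  move=> bu; rewrite climbs_belowE insert_beta_max insert_max.
  by split=> [[]//|]; split=> //=; apply: leq_trans bu _; apply: ltnW.
move: v; apply: (tree_ind tf) => [|v nv].
  rewrite emb_root; split=> H; first by have := climbs_below_root insert_tree H.
  by have := climbs_below_root tf H.
rewrite [_ T b (emb v)]climbs_belowE [_ f b v]climbs_belowE val_emb.
case: (boolP (v \in S)) => [Sv|nSv].
  rewrite (Sch Sv) insert_moved // insert_beta ?child_neq ?Sch //.
  rewrite climbs_belowE insert_self val_emb [_ f b i]climbs_belowE.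
  move=> IHi; split=> -[bv]; case=> [lt_b|H]; split=> //; auto.
    case: (ltnP (beta f v) b) => [|le_b]; [by left|right].
    apply/IHi; split; first exact: leq_trans le_b (ltnW (Sbeta Sv)).
    by right.
  case: (ltnP (beta f v) b) => [|le_b]; [by left|right].
  case/IHi: H => bi [lt_b|//]; apply/(climbs_max _ bv); left.
  exact: leq_ltn_trans insert_beta_self_ge lt_b.
case: (eqVneq v i) => [->|nvi] IHv;
  last by rewrite insert_beta // insert_fixed // IHv.
rewrite insert_self; split=> -[bi H]; split=> //; move: H;
  rewrite (climbs_max _ bi) IHv.
  by case=> // lt_b; left; exact: leq_ltn_trans insert_beta_self_ge lt_b.
by right.
Qed.

Lemma insert_leading v : leading T (emb v) = leading f v.
Proof.
by apply/idP/idP; rewrite !leadingP ?insert_tree // val_emb insert_climbs.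
Qed.

Lemma insert_leading_max : leading T ord_max = false.
Proof.
apply/negbTE/negP; rewrite leadingP ?insert_tree //; apply.
by rewrite climbs_belowE leqnn insert_beta_max; split=> //; left; apply: beta_lt.
Qed.

Lemma insert_lead : lead T = lead f.
Proof.
rewrite /lead card_emb insert_leading_max addn0.
by apply: eq_card => v; rewrite !inE insert_leading.
Qed.

(** A moved edge is improper before by [Sbeta], and after because its parent has the largest
    label. *)
Lemma insert_improper v : v != i -> improper_edge T (emb v) = improper_edge f v.
Proof.
move=> nvi; rewrite /improper_edge emb_eq_root insert_beta //.
case: (boolP (v \in S)) => [Sv|nSv]; last by rewrite insert_fixed // val_emb.
by rewrite insert_moved // (Sch Sv) Sbeta //= (leq_trans (beta_lt _ _)).
Qed.

Lemma insert_improper_max : improper_edge T ord_max = improper_edge f i.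
Proof. by rewrite /improper_edge insert_beta_max insert_max val_emb ni. Qed.

Lemma insert_improper_self : improper_edge T (emb i).
Proof.
rewrite /improper_edge insert_self emb_eq_root ni /=.
exact: leq_ltn_trans insert_beta_self_le (ltn_ord i).
Qed.

Lemma insert_impe : impe T = (impe f).+1.
Proof.
rewrite /impe card_emb insert_improper_max (cardsD1 i) [in RHS](cardsD1 i) !inE.
rewrite insert_improper_self -addnA add1n addnC; congr (_ + _).+1.
apply: eq_card => v; rewrite !inE.
by case: (eqVneq v i) => //= nvi; rewrite insert_improper.
Qed.

Lemma insert_improper_parent_max : improper_parent T ord_max.
Proof. by apply/existsP; exists (emb i);
  rewrite insert_improper_self insert_self /=. Qed.

Lemma insert_improper_parent v : v != i ->
  improper_parent T (emb v) = improper_parent f v.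
Proof.
move=> nvi; apply/existsP/existsP => [[x]|[w]].
  case: (embP x) => [|w].
    by rewrite insert_improper_max insert_max (inj_eq (@emb_inj _)); exists i.
  case: (boolP (w \in S)) => [Sw|nSw].
    by rewrite insert_moved // eq_sym emb_neq_max andbF.
  case: (eqVneq w i) => [->|nwi];
    first by rewrite insert_self eq_sym emb_neq_max andbF.
  by rewrite insert_improper // insert_fixed // (inj_eq (@emb_inj _)); exists w.
case: (eqVneq w i) => [->|nwi].
  by exists ord_max; rewrite insert_improper_max insert_max (inj_eq (@emb_inj _)).
case: (boolP (w \in S)) => [/Sch ->|nSw].
  by rewrite eq_sym (negbTE nvi) andbF.
by exists (emb w);
  rewrite insert_improper // insert_fixed // (inj_eq (@emb_inj _)).
Qed.

Lemma insert_improper_parent_self : improper_parent T (emb i) =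
  [exists k, [&& improper_edge f k, f k == i & k \notin S]].
Proof.
apply/existsP/existsP => [[x]|[w /and3P[iw /eqP fw nSw]]].
  case: (embP x) => [|w].
    rewrite insert_max (inj_eq (@emb_inj _)) => /andP[_ /eqP fi].
    by have := tree_acyclic tf ni; rewrite fi anc_refl.
  case: (boolP (w \in S)) => [Sw|nSw].
    by rewrite insert_moved // eq_sym emb_neq_max andbF.
  case: (eqVneq w i) => [->|nwi];
    first by rewrite insert_self eq_sym emb_neq_max andbF.
  rewrite insert_improper // insert_fixed // (inj_eq (@emb_inj _)) => /andP[iw
    fw].
  by exists w; rewrite iw fw.
exists (emb w); have nwi := child_neq fw.
by rewrite insert_improper // insert_fixed // fw eqxx andbT.
Qed.

(** Stated without subtraction: [ord_max] is a new improper parent, and [i] remains one exactly when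
    an improper child stays outside [S]. *)
Lemma insert_impp : impp T + improper_parent f i = (impp f).+1 +
  [exists k, [&& improper_edge f k, f k == i & k \notin S]].
Proof.
rewrite -insert_improper_parent_self /impp card_emb.
rewrite (cardsD1 i) [in RHS](cardsD1 i) !inE.
rewrite -!/(improper_parent _ _) insert_improper_parent_max.
rewrite (_ : #|_ :\ i| = #|[set j | improper_parent f j] :\ i|).
  by rewrite /improper_parent; lia.
apply: eq_card => v; rewrite !inE -!/(improper_parent _ _).
by case: (eqVneq v i) => //= nvi; rewrite insert_improper_parent.
Qed.

End Insert.

(** * Admissible sets of moved children, and contraction as the inverse of insertion *)

Section Contraction.
Variable m : nat.
Implicit Types (f : {ffun 'I_m.+1 -> 'I_m.+1}) (T : {ffun 'I_m.+2 -> 'I_m.+2}).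
Implicit Types (i j c v : 'I_m.+1) (S : {set 'I_m.+1}).

(** For an improper edge into [j], these are the children of [f j] up to and including [j] in the
    order of [beta], all improper. Improper edges thus index the moved sets of size s >= 1. *)
Definition lower_siblings f j := [set k | (f k == f j) && (beta f k <= beta f j)].

Lemma improper_parent_neq_root f j : improper_edge f j -> f j != root m.
Proof. by case/andP=> _ lt_j; apply/eqP => f0; rewrite f0 in lt_j. Qed.

Lemma lower_siblings_parent f j k : k \in lower_siblings f j -> f k = f j.
Proof. by rewrite inE => /andP[/eqP]. Qed.

Lemma lower_siblings_beta f j k : improper_edge f j ->
  k \in lower_siblings f j -> beta f k < f j.
Proof. by case/andP=> _ lt_j; rewrite inE => /andP[_ le_k];
  apply: leq_ltn_trans lt_j. Qed.

(** What stays below [f j] is [f j] itself and the subtrees of children with larger [beta] than [j].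
    So [f j] is recognisable in [T] as the child of [ord_max] with the largest [beta]. *)
Lemma lower_siblings_beta_insert f j k : is_tree f -> improper_edge f j ->
  let T := insert f (f j) (lower_siblings f j) in
  k \in lower_siblings f j -> beta T (emb k) < beta T (emb (f j)).
Proof.
move=> tf ij T Sk; have ni := improper_parent_neq_root ij.
have Sch := @lower_siblings_parent f j.
rewrite insert_beta ?(child_neq tf ni) ?Sch //.
have [w aw ->] := beta_attained T (emb (f j)); case: (embP w) aw => [_|v].
  exact: beta_lt.
case/(insert_anc_self_inv tf ni Sch) => [->|[l [fl]]]; rewrite val_emb.
  exact: lower_siblings_beta.
rewrite inE fl eqxx /= -ltnNge => lt_l lv; move: Sk; rewrite inE => /andP[_ le_k].
exact: leq_trans (leq_ltn_trans le_k lt_l) (beta_le lv).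
Qed.

(* unemb ord_max is the junk value ord0. *)
Definition unemb (x : 'I_m.+2) : 'I_m.+1 := odflt ord0 (unlift ord_max x).

Lemma embK : cancel (@emb m) unemb.
Proof. by move=> v; rewrite /unemb liftK. Qed.

Lemma unembK x : x != ord_max -> emb (unemb x) = x.
Proof. by case: (embP x) => [|v]; rewrite ?eqxx // embK. Qed.

Definition max_children T := [set y | T (emb y) == ord_max].

Lemma max_children_graft f p S : max_children (graft f p S) = S.
Proof.
by apply/setP => y; rewrite inE graft_emb; case: ifP; rewrite ?eqxx ?emb_neq_max.
Qed.

(** Inverse of [insert] when [c] is the child to be merged with [ord_max]; if [ord_max] is a leaf,
    it is deleted, whatever [c] is. *)
Definition contract T c : {ffun 'I_m.+1 -> 'I_m.+1} :=
  [ffun y => if T (emb y) == ord_max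
             then (if y == c then unemb (T ord_max) else c)
             else unemb (T (emb y))].

Lemma contract_insert f i S : (forall j, j \in S -> f j = i) ->
  contract (insert f i S) i = f.
Proof.
move=> Sch; apply/ffunP => y; rewrite ffunE /insert graft_emb graft_max in_setU1.
case: (eqVneq y i) => [->|nyi] /=; first by rewrite eqxx embK.
by case: (boolP (y \in S)) => [/Sch ->|_]; rewrite ?eqxx // emb_neq_max embK.
Qed.

Lemma tree_max T : is_tree T -> T ord_max != ord_max.
Proof.
move=> tT; apply/eqP => Tm; have := tree_acyclic tT (isT : ord_max != root m.+1).
by rewrite Tm anc_refl.
Qed.

Lemma insert_contract T c : is_tree T -> c \in max_children T ->
  insert (contract T c) c (max_children T :\ c) = T.
Proof.
move=> tT cT; apply/ffunP => x; rewrite /insert setD1K //; move: cT;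
  rewrite inE => cT.
case: (embP x) => [|y]; first by rewrite graft_max ffunE cT eqxx unembK ?tree_max.
by rewrite graft_emb inE ffunE; case: eqP => // /eqP/unembK ->.
Qed.

Lemma graft_contract T c : is_tree T -> max_children T = set0 ->
  graft (contract T c) (unemb (T ord_max)) set0 = T.
Proof.
move=> tT T0; apply/ffunP => x; case: (embP x) => [|y].
  by rewrite graft_max unembK ?tree_max.
have : y \notin max_children T by rewrite T0 inE.
by rewrite graft_emb inE inE ffunE => nT; rewrite (negbTE nT) unembK.
Qed.

Lemma contract_tree T c : is_tree T ->
  (max_children T != set0 -> c \in max_children T) -> is_tree (contract T c).
Proof.
move=> tT cT; set f := contract T c.
have f0 : f (root m) = root m.
  by rewrite ffunE emb_root tree_root //= -emb_root embK.
have fc : c \in max_children T -> f c = unemb (T ord_max).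
  by rewrite inE ffunE => ->; rewrite eqxx.
(* The vertex [ord_max] has no counterpart in the smaller tree, so the induction over [T] replaces
   it by its parent. *)
suff tr x : anc f (root m) (unemb (if x == ord_max then T x else x)).
  by apply/is_treeP; split=> // v; have := tr (emb v); rewrite emb_neq_max embK.
move: x; apply: (tree_ind tT) => [|x nx].
  by rewrite /= -emb_root embK anc_refl.
case: (embP x) nx => [|v] nx; first by rewrite eqxx (negbTE (tree_max tT)).
rewrite emb_neq_max embK; case: ifP => Tv IHv.
  have {}cT : c \in max_children T by apply: cT; apply/set0Pn; exists v;
    rewrite inE.
  have ac : anc f (root m) c by rewrite ancE fc // -(eqP Tv) IHv orbT.
  case: (eqVneq v c) => [->//|nvc].
  by rewrite ancE ffunE Tv (negbTE nvc) ac orbT.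
by rewrite ancE ffunE Tv IHv orbT.
Qed.

End Contraction.

(** * Splitting the sum over trees by the number of children of the largest label: none, one, or
    more *)

Lemma reindex_image (V : nmodType) (I J : finType) (h : I -> J)
    (P : pred I) (Q : pred J) (F : J -> V) :
  {in P &, injective h} -> (forall x, P x -> Q (h x)) ->
  (forall y, Q y -> exists2 x, P x & y = h x) ->
  (\sum_(y | Q y) F y = \sum_(x | P x) F (h x))%R.
Proof.
move=> hI hP hQ; rewrite (eq_bigl (mem (h @: [set x | P x]))) => [|y].
  rewrite big_imset /=; last by move=> x x'; rewrite !inE; exact: hI.
  by apply: eq_bigl => x; rewrite inE.
apply/idP/imsetP => [/hQ[x Px ->]|[x]]; first by exists x; rewrite ?inE.
by rewrite inE => Px ->; apply: hP.
Qed.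

Section Decomposition.
Variables (m : nat) (V : nmodType) (F : {ffun 'I_m.+2 -> 'I_m.+2} -> V).
Implicit Types (f : {ffun 'I_m.+1 -> 'I_m.+1}) (T : {ffun 'I_m.+2 -> 'I_m.+2}).

Lemma sum_leaf :
  (\sum_(T | is_tree T && (#|max_children T| == 0)) F T =
   \sum_(f | is_tree f) \sum_(v : 'I_m.+1) F (graft f v set0))%R.
Proof.
rewrite pair_big_dep /=;
  apply: (reindex_image (h := fun x => graft x.1 x.2 set0)).
- move=> [f v] [g w] _ _ /= eT.
  have -> : v = w.
    have := congr1 (fun T : {ffun _ -> _} => T ord_max) eT.
    by rewrite !graft_max => /emb_inj.
  suff -> : f = g by [].
  apply/ffunP => y; have := congr1 (fun T : {ffun _ -> _} => T (emb y)) eT.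
  by rewrite !graft_emb inE => /emb_inj.
- by move=> [f v] /andP[tf _]; rewrite leaf_tree // max_children_graft cards0.
- move=> T /andP[tT]; rewrite cards_eq0 => /eqP T0.
  (* Here [ord0] is a placeholder: the contraction only deletes the leaf. *)
  exists (contract T ord0, unemb (T ord_max)); last by rewrite graft_contract.
  by rewrite contract_tree // T0 eqxx.
Qed.

Lemma sum_edge :
  (\sum_(T | is_tree T && (#|max_children T| == 1)) F T =
   \sum_(f | is_tree f) \sum_(i | i != root m) F (insert f i set0))%R.
Proof.
rewrite pair_big_dep /=;
  apply: (reindex_image (h := fun x => insert x.1 x.2 set0)).
- move=> [f i] [g j] _ _ /= eT.
  have ij : i = j.
    have := congr1 (@max_children m) eT.
    by rewrite !max_children_graft !setU0 => /set1_inj.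
  rewrite -{}ij in eT *; congr pair.
  rewrite -(@contract_insert m f i set0) => [|k]; last by rewrite inE.
  by rewrite eT contract_insert // => k; rewrite inE.
- move=> [f i] /andP[tf ni]; rewrite insert_tree //= => [|k]; last by rewrite inE.
  by rewrite max_children_graft setU0 cards1.
- move=> T /andP[tT /cards1P[c Tc]].
  have cT : c \in max_children T by rewrite Tc inE.
  exists (contract T c, c); last first.
    by rewrite -{1}(insert_contract tT cT) Tc setDv.
  rewrite contract_tree //=; apply/eqP => c0; move: cT.
  by rewrite inE c0 emb_root tree_root.
Qed.

(** Insertions with s >= 1, indexed by the moved child [j] of largest [beta]. The enlarged tree
    determines in turn [f j], the moved set, [f] by contraction, and [j]. *)
Lemma sum_split :
  (\sum_(T | is_tree T && (1 < #|max_children T|)%N) F T =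
   \sum_(f | is_tree f) \sum_(j | improper_edge f j)
      F (insert f (f j) (lower_siblings f j)))%R.
Proof.
rewrite pair_big_dep /=.
apply: (reindex_image
  (h := fun x => insert x.1 (x.1 x.2) (lower_siblings x.1 x.2))).
- move=> [f j] [g k] /andP[/= tf ij] /andP[/= tg ik] eT.
  have eA : f j |: lower_siblings f j = g k |: lower_siblings g k.
    by have := congr1 (@max_children m) eT; rewrite !max_children_graft.
  have efg : f j = g k.
    (* Otherwise each of [f j] and [g k] is a moved child for the other, and each has strictly
       smaller [beta] than the other. *)
    apply/eqP; case: (eqVneq (f j) (g k)) => // nfg.
    have fS : f j \in lower_siblings g k.
      by have := setU11 (f j) (lower_siblings f j);
        rewrite eA in_setU1 (negbTE nfg).
    have gS : g k \in lower_siblings f j.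
      have := setU11 (g k) (lower_siblings g k).
      by rewrite -eA in_setU1 eq_sym (negbTE nfg).
    have := lower_siblings_beta_insert tf ij gS.
    by rewrite eT ltnNge (ltnW (lower_siblings_beta_insert tg ik fS)).
  have nself (h : {ffun 'I_m.+1 -> 'I_m.+1}) l : is_tree h -> improper_edge h l ->
      h l \notin lower_siblings h l.
    move=> th il; apply/negP => /lower_siblings_parent hl.
    by have := child_neq th (improper_parent_neq_root il) hl; rewrite eqxx.
  have eS : lower_siblings f j = lower_siblings g k.
    by rewrite -(setU1K (nself _ _ tf ij)) eA efg setU1K // nself.
  have ef : f = g.
    rewrite -(contract_insert (@lower_siblings_parent m f j)) eT efg.
    exact: contract_insert (@lower_siblings_parent m g k).
  move: eS ij ik efg; rewrite -{}ef => eS ij ik efg; congr pair.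
  (* Both [j] and [k] have the largest [beta] in the same moved set. *)
  apply: (tree_siblings_beta_inj tf) => //; try by [case/andP: ij|case/andP: ik].
  apply/eqP; rewrite eqn_leq.
  have : j \in lower_siblings f j by rewrite inE eqxx leqnn.
  rewrite eS inE efg eqxx /= => ->.
  have : k \in lower_siblings f k by rewrite inE eqxx leqnn.
  by rewrite -eS inE efg eqxx.
- move=> [f j] /andP[/= tf ij]; have ni := improper_parent_neq_root ij.
  have Sch := @lower_siblings_parent m f j.
  rewrite insert_tree //= max_children_graft cardsU1.
  have jS : j \in lower_siblings f j by rewrite inE eqxx leqnn.
  have -> : f j \notin lower_siblings f j.
    by apply/negP => /Sch fj; have := child_neq tf ni fj; rewrite eqxx.
  by rewrite add1n ltnS; apply/card_gt0P; exists j.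
- move=> T /andP[tT T2].
  have [c0 c0T] : exists c, c \in max_children T by apply/card_gt0P/ltnW.
  (* The vertex to merge with [ord_max] is its child of largest [beta]; [j] will be the best of the
     remaining children. *)
  have [c cT cmax] := arg_maxnP (fun y => beta T (emb y)) c0T.
  change (is_true (c \in max_children T)) in cT.
  pose f := contract T c; pose S := max_children T :\ c.
  have eT : insert f c S = T by apply: insert_contract.
  have tf : is_tree f by apply: contract_tree.
  have maxE y : y \in max_children T -> T (emb y) = ord_max by rewrite inE =>
    /eqP.
  have nroot y : y \in max_children T -> y != root m.
    by move/maxE=> Ty; apply/eqP => y0; move: Ty; rewrite y0 emb_root tree_root.
  have Sch y : y \in S -> f y = c.
    by rewrite !inE => /andP[/negbTE ny Ty]; rewrite ffunE Ty ny.
  have nc := nroot _ cT.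
  have Slt y : y \in S -> beta T (emb y) < beta T (emb c).
    move=> /setD1P[nyc yT]; rewrite ltn_neqAle (cmax y yT : _ <= _) andbT.
    apply: contraNneq nyc => eb; apply/eqP/(@emb_inj m).
    by apply: (tree_siblings_beta_inj tT) eb;
      rewrite ?emb_eq_root ?nroot // !maxE.
  have Sbeta y : y \in S -> beta T (emb y) = beta f y.
    by move=> yS; rewrite -eT insert_beta //; case/setD1P: yS.
  have [j0 j0S] : exists j, j \in S.
    apply/card_gt0P; move: T2; rewrite [#|max_children T|](cardsD1 c) cT.
    by rewrite add1n ltnS.
  have [j jS jmax] := arg_maxnP (beta f) j0S.
  change (is_true (j \in S)) in jS.
  have fj := Sch _ jS.
  have ij : improper_edge f j.
    rewrite /improper_edge nroot /=; last by case/setD1P: jS.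
    rewrite fj -Sbeta //; apply: leq_trans (Slt _ jS) _.
    by rewrite -(val_emb c) beta_le_self.
  exists (f, j); first by rewrite /= tf.
  rewrite /= fj -{1}eT; congr insert; apply/setP => y;
    rewrite [y \in lower_siblings _ _]inE fj.
  apply/idP/andP => [yS|[/eqP fy le_y]];
    first by rewrite Sch // (jmax y yS : _ <= _).
  (* A child [y] left below [c] would give [beta T (emb c) <= beta f y <= beta f j], contradicting
     the choice of [c]. *)
  apply/negPn/negP => nyS.
  have := insert_beta_self_child tf nc Sch fy nyS; rewrite eT => le_c.
  have := Slt _ jS; rewrite Sbeta // ltnNge => /negP; apply.
  exact: leq_trans le_c le_y.
Qed.

Lemma sum_trees_rec :
  (\sum_(T | is_tree T) F T = \sum_(f | is_tree f)
     (\sum_(v : 'I_m.+1) F (graft f v set0)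
      + \sum_(i | i != root m) F (insert f i set0)
      + \sum_(j | improper_edge f j) F (insert f (f j) (lower_siblings f j))))%R.
Proof.
rewrite !big_split /= -sum_leaf -sum_edge -sum_split.
rewrite (bigID (fun T => #|max_children T| == 0)) -addrA; congr (_ + _)%R.
rewrite (bigID (fun T => #|max_children T| == 1)); congr (_ + _)%R.
  by apply: eq_bigl => T; case: (is_tree T) => //=; lia.
by apply: eq_bigl => T; case: (is_tree T) => //=; lia.
Qed.

End Decomposition.

(** * Bounds on the root degree and on the number of leading vertices *)

Lemma tree_grow_ind m (P : pred {ffun 'I_m.+2 -> 'I_m.+2}) :
  (forall f v, is_tree f -> P (graft f v set0)) ->
  (forall f i, is_tree f -> i != root m -> P (insert f i set0)) ->
  (forall f j, is_tree f -> improper_edge f j ->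
     P (insert f (f j) (lower_siblings f j))) ->
  forall T, is_tree T -> P T.
Proof.
move=> Pleaf Pedge Psplit T tT.
(* The number of trees violating P is zero. *)
have := sum_trees_rec (fun T => ~~ P T : nat).
rewrite [RHS]big1 => [|f tf]; last first.
  rewrite !big1 // => [j ij|i ni|v _]; first by rewrite Psplit.
    by rewrite Pedge.
  by rewrite Pleaf.
by rewrite (bigD1 T) //=; case: (P T).
Qed.

Lemma lead_gt0 m (f : {ffun 'I_m.+1 -> 'I_m.+1}) : is_tree f -> 0 < lead f.
Proof.
move=> tf; apply/card_gt0P; exists (root m); rewrite inE leadingP //.
exact: climbs_below_root.
Qed.

(** Makes the truncated exponents of x and z exact once there are two vertices. A new leaf raises
    [lead] by one and the root degree by at most one; the other insertions change neither. *)
Lemma tree_deg_lead m (f : {ffun 'I_m.+1 -> 'I_m.+1}) : is_tree f ->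
  (0 < m -> 0 < deg_root f) /\ deg_root f < lead f.
Proof.
move=> tf; suff /andP[/implyP] : ((0 < m) ==> (0 < deg_root f)) && (deg_root f
  < lead f) by [].
elim: m f tf => [|m IHm] f tf.
  have -> : deg_root f = 0.
    by apply/eqP; rewrite cards_eq0; apply/eqP/setP => j;
      rewrite !inE (ord1 j) eqxx.
  exact: lead_gt0.
have m_gt0 (i : 'I_m.+1) : i != root m -> 0 < m.
  by case: m i {IHm f tf} => // i; rewrite (ord1 i) eqxx.
move: f tf; apply: tree_grow_ind => [f v|f i|f j] tf.
- have /andP[/implyP d_gt0 lt_d] := IHm f tf.
  rewrite leaf_deg // leaf_lead //;
    case: (eqVneq v (root m)) => [_|/m_gt0/d_gt0]; lia.
- move=> ni; have /andP[/implyP d_gt0 lt_d] := IHm f tf.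
  by rewrite insert_deg ?insert_lead ?(d_gt0 (m_gt0 _ ni)) // => k; rewrite inE.
move=> ij; have ni := improper_parent_neq_root ij.
have /andP[/implyP d_gt0 lt_d] := IHm f tf.
have Sch := @lower_siblings_parent m f j.
have Sb k := @lower_siblings_beta m f j k ij.
by rewrite insert_deg ?insert_lead ?(d_gt0 (m_gt0 _ ni)).
Qed.

(** * Improper children of largest [beta] *)

Section TopImproper.
Variables (m : nat) (f : {ffun 'I_m.+1 -> 'I_m.+1}).
Hypothesis tf : is_tree f.

(** The case s < r: after moving [lower_siblings f j], the vertex [f j] still has an improper
    child. *)
Definition has_higher_sibling j :=
  [exists k, [&& improper_edge f k, f k == f j & k \notin lower_siblings f j]].

Lemma has_higher_siblingPn j k : ~~ has_higher_sibling j -> improper_edge f k ->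
  f k = f j -> beta f k <= beta f j.
Proof.
move=> nh ik fk; apply: contraR nh; rewrite -ltnNge => lt_j; apply/existsP.
by exists k; rewrite ik fk inE eqxx fk eqxx /= -ltnNge.
Qed.

(** Every improper parent has exactly one improper child of largest [beta]. *)
Lemma card_top_improper :
  #|[set j | improper_edge f j && ~~ has_higher_sibling j]| = impp f.
Proof.
rewrite -(card_in_imset (f := f)) => [|j k]; last first.
  rewrite !inE => /andP[ij nj] /andP[ik nk] fjk.
  apply: (tree_siblings_beta_inj tf) => //; try by [case/andP: ij|case/andP: ik].
  by apply/eqP; rewrite eqn_leq !has_higher_siblingPn.
apply: eq_card => i; rewrite inE; apply/imsetP/existsP => [[j]|[j0 ij0]].
  by rewrite inE => /andP[ij _] ->; exists j; rewrite ij /=.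
have [j /andP[ij /eqP fj] jmax] :=
  arg_maxnP (P := fun j => improper_edge f j && (f j == i)) (beta f) ij0.
exists j; rewrite ?fj // inE ij; apply/existsPn => k; rewrite !inE fj.
apply/negP => /and3P[ik fk]; rewrite fk /= => /negP; apply.
by apply: jmax; rewrite ik.
Qed.

Lemma card_nontop_improper :
  #|[set j | improper_edge f j && has_higher_sibling j]| = impe f - impp f.
Proof.
rewrite -card_top_improper /impe.
rewrite -(cardsID [set j | has_higher_sibling j] [set j | improper_edge f j]).
rewrite (_ : _ :&: _ = [set j | improper_edge f j && has_higher_sibling j]).
  rewrite (_ : _ :\: _ = [set j | improper_edge f j && ~~ has_higher_sibling j]).
    by rewrite addnK.
  by apply/setP => j; rewrite !inE andbC.
by apply/setP => j; rewrite !inE.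
Qed.

End TopImproper.

Local Open Scope ring_scope.

(** * The recurrence for the weighted sum over trees *)

Section Weight.
Variables (R : comNzRingType) (x u z w : R).

Definition tree_weight m (f : {ffun 'I_m.+1 -> 'I_m.+1}) : R :=
  u ^+ (impe f - impp f) * w ^+ impp f * x ^+ (deg_root f - 1)
  * z ^+ (lead f - deg_root f - 1).

Section WeightRec.
Variables (m : nat) (f : {ffun 'I_m.+2 -> 'I_m.+2}).
Hypothesis tf : is_tree f.

(** The root contributes x and each of the [m.+1] other vertices z; [tree_deg_lead] ensures that the
    truncated exponents really grow by one. *)
Lemma sum_weight_leaf :
  \sum_(v : 'I_m.+2) tree_weight (graft f v set0)
    = (x + m.+1%:R * z) * tree_weight f.
Proof.
have [/(_ isT) d_gt0 lt_d] := tree_deg_lead tf.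
rewrite (bigD1 (root m.+1)) //= (eq_bigr (fun=> z * tree_weight f)) => [|v nv].
  rewrite sumr_const cardC1 card_ord /=.
  have -> : tree_weight (graft f (root m.+1) set0) = x * tree_weight f.
    rewrite /tree_weight leaf_impe // leaf_impp // leaf_deg // leaf_lead // eqxx.
    rewrite (_ : (_ + _ - 1 = (deg_root f - 1).+1)%N); last lia.
    rewrite (_ : (_ - (_ + _) - 1 = lead f - deg_root f - 1)%N); last lia.
    by rewrite exprS; ring.
  by rewrite -mulr_natl; ring.
rewrite /tree_weight leaf_impe // leaf_impp // leaf_deg // leaf_lead // (negbTE
  nv) addn0.
rewrite (_ : ((lead f).+1 - _ - 1 = (lead f - deg_root f - 1).+1)%N); last lia.
by rewrite exprS; ring.
Qed.

(** With nothing moved, [i] keeps its status, so [impe] and [impp] both grow by one. *)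
Lemma sum_weight_edge :
  \sum_(i | i != root m.+1) tree_weight (insert f i set0)
    = m.+1%:R * w * tree_weight f.
Proof.
rewrite (eq_bigr (fun=> w * tree_weight f)) => [|i ni].
  by rewrite sumr_const cardC1 card_ord /= -mulr_natl; ring.
have S0 (P : 'I_m.+2 -> Prop) j : j \in set0 -> P j by rewrite inE.
have Sch := S0 (fun j => f j = i).
have Sb := S0 (fun j => (beta f j < i)%N).
have e_impp := insert_impp tf ni Sch Sb.
rewrite /tree_weight insert_impe // insert_lead // insert_deg //.
have -> : impp (insert f i set0) = (impp f).+1.
  have eq_h : [exists k, [&& improper_edge f k, f k == i & k \notin set0]]
      = improper_parent f i.
    by apply: eq_existsb => k; rewrite inE andbT.
  by move: e_impp; rewrite eq_h => /addIn.
by rewrite subSS exprS; ring.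
Qed.

(** If an improper child stays at [f j], then [impp] grows along with [impe], a factor w; otherwise
    [impp] is unchanged, a factor u. *)
Lemma sum_weight_split :
  \sum_(j | improper_edge f j)
     tree_weight (insert f (f j) (lower_siblings f j))
  = (impe f - impp f)%:R * w * tree_weight f
    + (impp f)%:R * u * tree_weight f.
Proof.
have wE j : improper_edge f j ->
    tree_weight (insert f (f j) (lower_siblings f j)) =
    (if has_higher_sibling f j then w else u) * tree_weight f.
  move=> ij; have ni := improper_parent_neq_root ij.
  have Sch := @lower_siblings_parent _ f j.
  have Sb k := @lower_siblings_beta _ f j k ij.
  have := insert_impp tf ni Sch Sb; rewrite -/(has_higher_sibling f j).
  have -> : improper_parent f (f j) by apply/existsP; exists j; rewrite ij /=.
  have le_i := impp_le_impe f.
  rewrite /tree_weight insert_impe // insert_lead // insert_deg //.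
  case: (has_higher_sibling f j) => e_impp.
    have -> : impp (insert f (f j) (lower_siblings f j)) = (impp f).+1 by lia.
    by rewrite subSS exprS; ring.
  have -> : impp (insert f (f j) (lower_siblings f j)) = impp f by lia.
  by rewrite subSn // exprS; ring.
rewrite (bigID (has_higher_sibling f)) /=; congr (_ + _).
  rewrite (eq_bigr (fun=> w * tree_weight f)) => [|j /andP[ij hj]].
    by rewrite sumr_const -cardsE card_nontop_improper // -mulr_natl; ring.
  by rewrite wE // hj.
rewrite (eq_bigr (fun=> u * tree_weight f)) => [|j /andP[ij hj]].
  by rewrite sumr_const -cardsE card_top_improper // -mulr_natl; ring.
by rewrite wE // (negbTE hj).
Qed.

End WeightRec.

Lemma sum_weight_rec m :
  \sum_(T : {ffun 'I_m.+3 -> 'I_m.+3} | is_tree T) tree_weight T =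
  \sum_(f : {ffun 'I_m.+2 -> 'I_m.+2} | is_tree f)
    ((x + m.+1%:R * z + m.+1%:R * w) * tree_weight f
     + ((impe f - impp f)%:R * w * tree_weight f
        + (impp f)%:R * u * tree_weight f)).
Proof.
rewrite sum_trees_rec; apply: eq_bigr => f tf.
by rewrite sum_weight_leaf // sum_weight_edge // sum_weight_split // -mulrDl.
Qed.

(** Base case at two vertices: the one-vertex tree admits only the leaf at its root. *)
Lemma sum_weight_two : \sum_(f : {ffun 'I_2 -> 'I_2} | is_tree f) tree_weight f
  = 1.
Proof.
have t1 (f : {ffun 'I_1 -> 'I_1}) : is_tree f.
  apply/is_treeP; split=> [|v]; first by rewrite (ord1 (f _)) (ord1 (root 0)).
  by rewrite (ord1 v) (ord1 (root 0)) anc_refl.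
have e1 (f : {ffun 'I_1 -> 'I_1}) : f = [ffun=> ord0].
  by apply/ffunP => v; rewrite ffunE (ord1 (f v)).
have imp0 (f : {ffun 'I_1 -> 'I_1}) j : improper_edge f j = false.
  by rewrite /improper_edge (ord1 j) eqxx.
rewrite sum_trees_rec (big_pred1 [ffun=> ord0]) => [|f]; last first.
  by rewrite t1 [f]e1 /= eqxx.
set f := [ffun=> ord0]; rewrite big_ord1.
rewrite [X in _ + X + _]big_pred0 => [|i]; last by rewrite (ord1 i) eqxx.
rewrite [X in _ + X]big_pred0 => [|j]; last exact: imp0.
have i0 : impe f = 0%N by apply/eqP; rewrite cards_eq0; apply/eqP/setP => j;
  rewrite !inE imp0.
have p0 : impp f = 0%N by have := impp_le_impe f; rewrite i0 leqn0 => /eqP.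
have d0 : deg_root f = 0%N.
  by apply/eqP; rewrite cards_eq0; apply/eqP/setP => j;
    rewrite !inE (ord1 j) eqxx.
have l1 : lead f = 1%N.
  apply/eqP; rewrite eqn_leq lead_gt0 // andbT.
  by apply: leq_trans (max_card _) _; rewrite card_ord.
rewrite /tree_weight leaf_impe // leaf_impp // leaf_deg // leaf_lead //.
by rewrite i0 p0 d0 l1 /= !addr0 !mulr1.
Qed.

End Weight.

(** * From the combinatorial recurrence to the differential one *)

Lemma mul_mderiv_exp n (R : comNzRingType) (i : 'I_n) (p : {mpoly R[n]}) k :
  p * mderiv i (p ^+ k) = k%:R * p ^+ k * mderiv i p.
Proof.
elim: k => [|k IHk]; first by rewrite expr0 -mpolyC1 mderivC mulr0 !mul0r.
by rewrite exprS mderivM mulrDr IHk -natr1; ring.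
Qed.

Lemma mderiv_var (i j : 'I_4) : mderiv i ('X_j : P4) = (i == j)%:R.
Proof.
rewrite mderivX mnm1E eq_sym; case: eqP => [->|_]; last by rewrite scale0r.
rewrite scale1r -mpolyX0; congr 'X_[_]; apply/mnmP => k.
by rewrite mnmBE subnn mnm0E.
Qed.

Lemma mderiv_exp0 n (R : comNzRingType) (i : 'I_n) (p : {mpoly R[n]}) k :
  mderiv i p = 0 -> mderiv i (p ^+ k) = 0.
Proof.
move=> p0; elim: k => [|k IHk]; first by rewrite expr0 -mpolyC1 mderivC.
by rewrite exprS mderivM p0 IHk mul0r mulr0 addr0.
Qed.

(** Both y and y + t have derivative 1 in y, so the derivative in y acts as d/du + d/dw on the
    weight. *)
Lemma mderiv_weight m (f : {ffun 'I_m.+1 -> 'I_m.+1}) :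
  let W := tree_weight vx vy vz (vy + vt) f in
  (vy + vt) * (vy * mderiv iy W)
  = (impe f - impp f)%:R * (vy + vt) * W + (impp f)%:R * vy * W.
Proof.
rewrite /= /tree_weight -!mulrA; set X := vx ^+ _ * vz ^+ _.
have dX : mderiv iy X = 0.
  by rewrite mderivM !mderiv_exp0 ?mderiv_var // mul0r mulr0 addr0.
set a := (_ - _)%N; set b := impp f.
have du := mul_mderiv_exp iy vy a; have dw := mul_mderiv_exp iy (vy + vt) b.
rewrite [mderiv iy vy]mderiv_var /= mulr1 in du.
rewrite mderivD !mderiv_var /= addr0 mulr1 in dw.
rewrite mderivM [mderiv iy (_ * X)]mderivM dX mulr0 addr0.
(* Each derivative of a power is paired with its own base, which avoids the exponents [a - 1] and
   [b - 1]. *)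
transitivity ((vy + vt) * (vy * mderiv iy (vy ^+ a)) * ((vy + vt) ^+ b * X)
  + vy * vy ^+ a * ((vy + vt) * mderiv iy ((vy + vt) ^+ b)) * X); first by ring.
by rewrite du dw; ring.
Qed.

Lemma Qaux_trees k : Qaux k =
  \sum_(f : {ffun 'I_k.+2 -> 'I_k.+2} | is_tree f) tree_weight vx vy vz (vy +
    vt) f.
Proof.
elim: k => [|k IHk] /=; first by rewrite sum_weight_two.
rewrite sum_weight_rec IHk /Qstep [mderiv iy _]raddf_sum !mulr_sumr /=
  -!big_split /=.
rewrite mulr_sumr -big_split /=; apply: eq_bigr => f tf;
  rewrite -(mderiv_weight f).
move: (tree_weight _ _ _ _ f) => W; move: (mderiv iy W) => dW.
by ring.
Qed.

Theorem theorem13 (n : nat) : (1 <= n)%N ->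
  Rpoly n =
  \sum_(f : {ffun 'I_n.+1 -> 'I_n.+1} | is_tree f)
     (vy + 1) ^+ (impe f - impp f) * (vy + vt) ^+ impp f
     * vx ^+ (deg_root f - 1) * vz ^+ (lead f - deg_root f - 1).
Proof.
case: n => // k _; rewrite /Rpoly /Q /= Qaux_trees; set s := [tuple _; _; _; _].
have sx : vx \mPo s = vx by exact: comp_mpolyXU.
have sy : vy \mPo s = vy + 1 by exact: comp_mpolyXU.
have sz : vz \mPo s = vz by exact: comp_mpolyXU.
have st : vt \mPo s = vt - 1 by exact: comp_mpolyXU.
rewrite raddf_sum /=; apply: eq_bigr => f _.
rewrite /tree_weight !rmorphM !rmorphXn rmorphD /= sx sy sz st.
(* The shifts cancel in [(vy + 1) + (vt - 1)], so the base y + t is preserved. *)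
by rewrite addrACA subrr addr0.
Qed.
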